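(* Let $p$ be an odd positive integer and let $T_{p,2}$ be the $(p,2)$-torus knot. Then $$F(T_{p,2})\le\frac{p^2-1}{2},$$ where $F$ denotes the forbidden number.
   Context: A virtual knot is an equivalence class of (oriented) virtual knot diagrams, with classical and virtual crossings, modulo the extended Reidemeister moves: the classical moves $R1,R2,R3$, the virtual moves $V1,V2,V3$ and the semivirtual move $SV$. Classical knots are regarded as virtual knots. The Gauss diagram of a diagram is an oriented circle with one signed arrow (chord) per classical crossing; the two endpoints of the arrow are the two passages through that crossing, the arrow points from the overcrossing (tail) to the undercrossing (head), and it carries the sign $\pm1$ of the crossing. The moves $V1,V2,V3,SV$ do not change the Gauss diagram, every Gauss diagram is realized by a virtual knot diagram, and virtual knots correspond to Gauss diagrams modulo the Gauss diagram versions of $R1,R2,R3$. The forbidden moves: $FO$ moves a strand of the diagram over a virtual crossing; on Gauss diagrams it interchanges two adjacent tails of two different arrows. $FU$ moves a strand under a virtual crossing; on Gauss diagrams it interchanges two adjacent heads of two different arrows. Signs of arrows are arbitrary and unchanged in both moves. The forbidden number $F(K)$ is the minimum number of forbidden moves needed to transform $K$ into the unknot, taken over all diagrams of $K$ and with unlimited use of extended Reidemeister moves. The $(p,2)$-torus knot $T_{p,2}$ ($p$ odd) is the classical knot with Gauss diagram consisting of $p$ pairwise crossing arrows, all of positive sign, with heads and tails alternating around the circle. *)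

(* Defs.v *)
(* MathComp world, with the classical axioms of mathcomp.classical.boolp. *)
From Stdlib Require Import Relations.
From HB Require Import structures.
From mathcomp Require Import all_boot.
From mathcomp Require Import generic_quotient.
From mathcomp Require Import boolp.

Set Implicit Arguments.
Unset Strict Implicit.
Unset Printing Implicit Defensive.

Local Open Scope quotient_scope.

(* A Gauss diagram is recorded by its signed Gauss code: cutting the oriented
   circle at a base point and listing the endpoints of the arrows.  An endpoint
   (a, t, s) belongs to the arrow labelled a; t is true at the tail (the
   overpass) and false at the head (the underpass); s is true iff the arrow has
   sign +1.  The choice of base point and labels is forgotten by the
   constructors [rotate] and [relabel] of [reidemeister]. *)
Definition endpoint : Type := (nat * bool * bool)%type.

Notation tail a s := ((a, true, s) : endpoint).
Notation head a s := ((a, false, s) : endpoint).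

Definition other_end (e : endpoint) : endpoint := (e.1.1, ~~ e.1.2, e.2).

(* Each arrow that occurs has exactly one tail and one head, of the same sign. *)
Definition gauss_code (w : seq endpoint) : bool :=
  uniq [seq e.1 | e <- w] && all (fun e => other_end e \in w) w.

Record gauss_diagram := GaussDiagram {
  code :> seq endpoint;
  _ : gauss_code code }.

HB.instance Definition _ := [isSub for code].
HB.instance Definition _ := [Choice of gauss_diagram by <:].

Definition ordered (o : bool) (x y : endpoint) : seq endpoint :=
  if o then [:: x; y] else [:: y; x].

(* R1 removes an isolated arrow, of any sign and direction.  R2 removes two
   arrows of opposite signs with adjacent tails and adjacent heads; [o] tells
   whether the two strands are parallel or antiparallel.

   In R3 the arrows a, b, c are the crossings top/middle, top/bottom and
   middle/bottom of three strands, which bound a triangle with vertices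
   A, B, C.  Identify true, false with 1, -1.  If the top, middle and bottom
   strands run along x(B - A), y(C - A) and z(C - B), and the triangle ABC has
   orientation d, then the sign of a crossing, being that of
   det(over, under), is xyd, xzd and yzd at a, b and c respectively; a product
   of three signs is a ternary exclusive or.  The move reverses the three
   strands' orders x, y, z and keeps d.  The quadruples (x, y, z, d) thus give
   exactly the eight oriented R3 moves, each in both directions.  The flag [k]
   chooses the cyclic order in which the knot runs through the strands. *)
Inductive reidemeister : seq endpoint -> seq endpoint -> Prop :=
| rotate u v : reidemeister (u ++ v) (v ++ u)
| relabel f w : injective f ->
    reidemeister w [seq (f e.1.1, e.1.2, e.2) | e : endpoint <- w]
| R1 a t s w : reidemeister [:: (a, t, s), (a, ~~ t, s) & w] w
| R2 a b s o u v :
    reidemeister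
      ([:: tail a s; tail b (~~ s)] ++ u ++
       ordered o (head a s) (head b (~~ s)) ++ v)
      (u ++ v)
| R3 a b c (x y z d k : bool) u v w :
    let sa := x (+) y (+) d in
    let sb := x (+) z (+) d in
    let sc := y (+) z (+) d in
    let top x' := ordered x' (tail a sa) (tail b sb) in
    let mid y' := ordered y' (head a sa) (tail c sc) in
    let bot z' := ordered z' (head b sb) (head c sc) in
    let arrange T M B :=
      T ++ u ++ (if k then M ++ v ++ B else B ++ v ++ M) ++ w in
    reidemeister (arrange (top x) (mid y) (bot z))
                 (arrange (top (~~ x)) (mid (~~ y)) (bot (~~ z))).

(* Requiring both codes to belong to Gauss diagrams makes the labels of the
   arrows in a move distinct, and fresh when arrows are created. *)
Definition same_knot : relation gauss_diagram :=
  clos_refl_sym_trans gauss_diagram (fun D D' => reidemeister D D').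

Definition same_knotb (D D' : gauss_diagram) : bool := `[< same_knot D D' >].

Lemma same_knotb_refl : reflexive same_knotb.
Proof. by move=> D; apply/asboolP/rst_refl. Qed.

Lemma same_knotb_sym : symmetric same_knotb.
Proof.
by move=> D D'; apply/idP/idP => /asboolP h; apply/asboolP; apply: rst_sym h.
Qed.

Lemma same_knotb_trans : transitive same_knotb.
Proof.
move=> D2 D1 D3 /asboolP h12 /asboolP h23.
by apply/asboolP; apply: rst_trans h12 h23.
Qed.

Canonical same_knot_equiv :=
  EquivRel same_knotb same_knotb_refl same_knotb_sym same_knotb_trans.

Definition virtual_knot := {eq_quot same_knotb}.

Definition knot_of (D : gauss_diagram) : virtual_knot := \pi_virtual_knot D.

Lemma knot_ofP (D D' : gauss_diagram) :
  knot_of D = knot_of D' <-> same_knot D D'.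
Proof.
split; first by move=> /eqmodP /asboolP.
by move=> h; apply/eqmodP/asboolP.
Qed.

(* The two arrows are distinct because both codes belong to Gauss diagrams. *)
Inductive forbidden_move : seq endpoint -> seq endpoint -> Prop :=
| FO a s b s' w :
    forbidden_move [:: tail a s, tail b s' & w] [:: tail b s', tail a s & w]
| FU a s b s' w :
    forbidden_move [:: head a s, head b s' & w] [:: head b s', head a s & w].

Definition forbidden_step (K K' : virtual_knot) : Prop :=
  exists D D' : gauss_diagram,
    [/\ knot_of D = K, knot_of D' = K' & forbidden_move D D'].

(* A transformation of K into K' by extended Reidemeister moves and exactly n
   forbidden moves. *)
Fixpoint forbidden_path (n : nat) (K K' : virtual_knot) : Prop :=
  if n is m.+1 then exists2 K1, forbidden_step K K1 & forbidden_path m K1 K'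
  else K = K'.

Definition empty_diagram : gauss_diagram := @GaussDiagram [::] isT.

Definition unknot : virtual_knot := knot_of empty_diagram.

(* F(K) = m, where F is the forbidden number. *)
Definition is_forbidden_number (K : virtual_knot) (m : nat) : Prop :=
  forbidden_path m K unknot /\
  (forall n, forbidden_path n K unknot -> m <= n).

(* Among 2p endpoints with alternating tails and heads, the j-th and the
   (j + p)-th are joined by an arrow: these are all the diameters. *)
Definition torus_code (p : nat) : seq endpoint :=
  mkseq (fun j => (j %% p, ~~ odd j, true)) (2 * p).

Lemma torus_codeP (p : nat) : odd p -> gauss_code (torus_code p).
Proof.
move=> podd; have p0 : 0 < p by case: p podd.
have lift j : j < 2 * p -> exists2 i, i < 2 * p &
    (i %% p = j %% p) /\ odd i = ~~ odd j.
  move=> jlt; case: (ltnP j p) => jp.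
    exists (j + p); first by rewrite mul2n -addnn ltn_add2r.
    by rewrite modnDr oddD podd addbT.
  exists (j - p); first exact: leq_ltn_trans (leq_subr _ _) jlt.
  by rewrite -[in RHS](subnK jp) modnDr oddB // podd addbT.
apply/andP; split.
  rewrite -map_comp map_inj_in_uniq ?iota_uniq // => i j.
  rewrite !mem_iota /= !add0n => ilt jlt [eqm /negb_inj eqo].
  have quo q : q < 2 * p -> q %/ p = odd q (+) odd (q %% p).
    move=> qlt; have /(congr1 odd) := divn_eq q p.
    rewrite oddD oddM podd andbT => ->; rewrite addbK.
    by move: qlt; rewrite -ltn_divLR //; case: (q %/ p) => [|[|]].
  by rewrite (divn_eq i p) (divn_eq j p) (quo i ilt) (quo j jlt) eqm eqo.
apply/allP => _ /mapP[j jlt ->]; move: jlt; rewrite mem_iota /= add0n => jlt.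
have [i ilt [eqm eqo]] := lift j jlt.
have -> : other_end (j %% p, ~~ odd j, true) = (i %% p, ~~ odd i, true).
  by rewrite /other_end /= eqm eqo.
by apply: map_f; rewrite mem_iota.
Qed.

Definition torus_diagram (p : nat) (podd : odd p) : gauss_diagram :=
  GaussDiagram (torus_codeP podd).

(* T_{p,2} *)
Definition torus_knot (p : nat) (podd : odd p) : virtual_knot :=
  knot_of (torus_diagram podd).

(* Main.v *)
From Stdlib Require Import Relations.
From mathcomp Require Import all_boot boolp zify.
Require Import Defs.

Set Implicit Arguments.
Unset Strict Implicit.
Unset Printing Implicit Defensive.

(** Let p = 2k + 1, and write O and U for the tail and the head of an arrow.
The code of the torus knot is

  O0 [U1 O2 U3 O4 ... U(2k-1) O(2k)] U0 [O1 U2 O3 U4 ... O(2k-1) U(2k)].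

A tail may pass a head at the price of two forbidden moves
([reach_under_over]): an R2 move creates a parallel pair of arrows x, y of
opposite signs, an R3 move exchanges the tail and the head at the cost of also
exchanging one end of each of the two arrows with an end of x, and an FO and an
FU undo these two side effects, after which x and y cancel.

The idea is to pay this price in the first bracket only.  There all tails are
moved in front of all heads, and the heads are put in decreasing order:

  O0 O2 ... O(2k) U(2k-1) ... U3 U1 U0 [O1 U2 O3 U4 ... O(2k-1) U(2k)]

([reach_gather]).  Now the second bracket separates for free.  Indeed for an
odd a and an even b the R3 move exchanges O(a) with U(b) provided that O(x),
O(b) are adjacent and U(a), U(x) are adjacent for some third arrow x, and in the
word above such an x is at hand at every stage: U2 passes O1 by means of x = 0,
then U4 passes O3 by means of x = 0 and O1 by means of x = 2, and in general
x = b - a - 1 ([reach_cascade], [reach_unwind]).  In the end the code is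

  O(2k) ... O2 O0 (U0 U(2k-1) U2 U(2k-3) ... U1 U(2k)) O1 O3 ... O(2k-1),

where the heads of the even arrows, increasing, alternate with those of the odd
arrows, decreasing.  Moving the former in front of the latter
([reach_unriffle]) leaves two families of nested arrows, which R1 moves remove
([reach_nested]).

The first stage costs 'C(k, 2) moves between heads and two for each of the
'C(k+1, 2) passages of a tail in front of a head, and the last stage costs
'C(k+1, 2).  The total is k(2k + 1) = 'C(p, 2), which is at most
(p^2 - 1) / 2 = 2k(k + 1). *)

(** * Codes connected by a bounded number of forbidden moves *)

Lemma forbidden_path_cat m n K1 K2 K3 :
  forbidden_path m K1 K2 -> forbidden_path n K2 K3 ->
  forbidden_path (m + n) K1 K3.
Proof.
elim: m K1 => [|m IHm] K1 /=; first by move->.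
by case=> K step path12 path23; exists K => //; apply: IHm path23.
Qed.

(** Validity of the target is part of the conclusion, so that chains of moves
can be composed without tracking it.  The bound is only an upper one, so that
swaps that happen to be free need no separate treatment. *)
Definition reach n (w w' : seq endpoint) : Prop :=
  forall gw : gauss_code w, exists gw' : gauss_code w', exists2 m, m <= n &
    forbidden_path m (knot_of (GaussDiagram gw)) (knot_of (GaussDiagram gw')).

Lemma reach_refl w : reach 0 w w.
Proof. by move=> gw; exists gw; exists 0. Qed.

Lemma reach_weaken m n w w' : m <= n -> reach m w w' -> reach n w w'.
Proof.
move=> le_mn r gw; have [gw' [i le_im path]] := r gw.
by exists gw'; exists i => //; apply: leq_trans le_mn.
Qed.

Lemma reach_trans m n w1 w2 w3 :
  reach m w1 w2 -> reach n w2 w3 -> reach (m + n) w1 w3.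
Proof.
move=> r12 r23 g1; have [g2 [i le_im path12]] := r12 g1.
have [g3 [j le_jn path23]] := r23 g2; exists g3; exists (i + j).
  exact: leq_add.
exact: forbidden_path_cat path12 path23.
Qed.

Lemma reach0_trans n w1 w2 w3 : reach 0 w1 w2 -> reach n w2 w3 -> reach n w1 w3.
Proof. exact: (@reach_trans 0). Qed.

Lemma reach_trans0 n w1 w2 w3 : reach n w1 w2 -> reach 0 w2 w3 -> reach n w1 w3.
Proof. by move=> r12 r23; rewrite -[n]addn0; apply: reach_trans r23. Qed.

Lemma perm_gauss_code w w' : perm_eq w w' -> gauss_code w -> gauss_code w'.
Proof.
move=> eqw /andP[uw /allP cw]; apply/andP; split.
  by rewrite -(perm_uniq (perm_map (fun e => e.1) eqw)).
by apply/allP=> e; rewrite -!(perm_mem eqw); apply: cw.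
Qed.

Lemma reach_reidemeister w w' :
  reidemeister w w' -> (gauss_code w -> gauss_code w') -> reach 0 w w'.
Proof.
move=> r g gw; exists (g gw); exists 0 => //=; apply/knot_ofP.
exact: rst_step.
Qed.

Lemma reach_reidemeister_inv w w' :
  reidemeister w w' -> (gauss_code w' -> gauss_code w) -> reach 0 w' w.
Proof.
move=> r g gw'; exists (g gw'); exists 0 => //=; apply/knot_ofP.
by apply: rst_sym; apply: rst_step.
Qed.

Lemma reach_forbidden w w' :
  forbidden_move w w' -> perm_eq w w' -> reach 1 w w'.
Proof.
move=> f eqw gw; exists (perm_gauss_code eqw gw); exists 1 => //=.
by eexists; last by []; eexists; eexists; split=> //.
Qed.

Lemma reach_rot u v : reach 0 (u ++ v) (v ++ u).
Proof.
apply: reach_reidemeister; first exact: rotate.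
by apply: perm_gauss_code; rewrite perm_catC.
Qed.

Lemma reach_rotate n u v u' v' :
  reach n (v ++ u) (v' ++ u') -> reach n (u ++ v) (u' ++ v').
Proof.
move=> r; apply: (reach0_trans (@reach_rot u v)).
exact: (reach_trans0 r (@reach_rot v' u')).
Qed.

(** A move that is available at the base point is available anywhere, since
the base point can be moved there and back. *)
Lemma reach_conj n u v v' :
  (forall w, reach n (v ++ w) (v' ++ w)) ->
  forall w, reach n (u ++ v ++ w) (u ++ v' ++ w).
Proof. by move=> r w; apply: reach_rotate; rewrite -!catA. Qed.

Lemma reach_block_swap n (l m : seq endpoint) :
  (forall x y u v, x \in l -> y \in m ->
     reach n (u ++ [:: x, y & v]) (u ++ [:: y, x & v])) ->
  forall u v, reach (n * size l * size m) (u ++ l ++ m ++ v) (u ++ m ++ l ++ v).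
Proof.
elim: l => [|x l IHl] swap u v; first by rewrite muln0; apply: reach_refl.
have pass m' u' : {subset m' <= m} ->
    reach (n * size m') (u' ++ x :: m' ++ l ++ v) (u' ++ m' ++ x :: l ++ v).
  elim: m' u' => [|y m' IHm] u' sub; first by rewrite muln0; apply: reach_refl.
  rewrite /= mulnS; apply: reach_trans.
    by apply: swap; rewrite ?mem_head // sub ?mem_head.
  have := IHm (rcons u' y); rewrite !cat_rcons; apply=> z zm.
  by apply: sub; rewrite inE zm orbT.
have -> : n * size (x :: l) * size m = n * size l * size m + n * size m.
  by rewrite /= mulnS mulnDl addnC.
apply: reach_trans (@pass m u _) => //.
rewrite /= -!(cat_rcons x); apply: IHl => y z u' v' yl; apply: swap.
by rewrite inE yl orbT.
Qed.

(* Only arrows of sign +1 occur in the codes met on the way, apart from one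
   auxiliary arrow in the exchange of a tail and a head. *)
Notation over a := (tail a true).
Notation under a := (head a true).
Notation overs := (map (fun a : nat => over a)).
Notation unders := (map (fun a : nat => under a)).

(** * The moves inside a code *)

Lemma reach_FO a s b s' u v :
  reach 1 (u ++ [:: tail a s, tail b s' & v])
          (u ++ [:: tail b s', tail a s & v]).
Proof.
apply: (@reach_conj 1 u [:: tail a s; tail b s'] [:: tail b s'; tail a s]) => w.
apply: reach_forbidden; first exact: FO.
by apply/permP => q /=; lia.
Qed.

Lemma reach_FU a s b s' u v :
  reach 1 (u ++ [:: head a s, head b s' & v])
          (u ++ [:: head b s', head a s & v]).
Proof.
apply: (@reach_conj 1 u [:: head a s; head b s'] [:: head b s'; head a s]) => w.
apply: reach_forbidden; first exact: FU.
by apply/permP => q /=; lia.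
Qed.

Lemma other_endK : involutive other_end.
Proof. by case=> [[a []] s]. Qed.

Lemma gauss_code_del a t s w :
  gauss_code [:: (a, t, s), (a, ~~ t, s) & w] -> gauss_code w.
Proof.
move=> /andP[/= /and3P[]]; rewrite !inE !negb_or => /andP[_ at_w] ant_w uw.
move=> /and3P[_ _ /allP cw]; apply/andP; split=> //; apply/allP=> e ew.
have := cw e ew; rewrite !inE; case/or3P=> // /eqP oe.
- have ee : e = (a, ~~ t, s) by rewrite -[e]other_endK oe.
  by move: ant_w; rewrite (_ : (a, ~~ t) = e.1) ?map_f // ee.
- have ee : e = (a, t, s) by rewrite -[e]other_endK oe /other_end /= negbK.
  by move: at_w; rewrite (_ : (a, t) = e.1) ?map_f // ee.
Qed.

Lemma gauss_code_add a t s w :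
  a \notin [seq e.1.1 | e : endpoint <- w] -> gauss_code w ->
  gauss_code [:: (a, t, s), (a, ~~ t, s) & w].
Proof.
move=> fresh /andP[uw /allP cw].
have fresh1 t' : (a, t') \notin [seq e.1 | e : endpoint <- w].
  move: fresh; apply: contra => /mapP[e ew ea].
  by apply/mapP; exists e => //; rewrite -ea.
apply/andP; split.
  by rewrite /= inE negb_or !fresh1 uw xpair_eqE eqxx /=; case: t.
rewrite /= /other_end /= !inE negbK !eqxx !orbT /=; apply/allP=> e ew.
by rewrite !inE cw // !orbT.
Qed.

Lemma reach_R1 a t s u v :
  reach 0 (u ++ [:: (a, t, s), (a, ~~ t, s) & v]) (u ++ v).
Proof.
apply: (@reach_conj 0 u [:: (a, t, s); (a, ~~ t, s)] [::]) => w.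
apply: reach_reidemeister; [exact: R1 | exact: gauss_code_del].
Qed.

(** Remove the isolated arrow and create it again with the other direction. *)
Lemma reach_R1_swap a t s u v :
  reach 0 (u ++ [:: (a, t, s), (a, ~~ t, s) & v])
          (u ++ [:: (a, ~~ t, s), (a, t, s) & v]).
Proof.
apply: (@reach_conj 0 u [:: (a, t, s); (a, ~~ t, s)]
                        [:: (a, ~~ t, s); (a, t, s)]) => w gw.
have gw0 : gauss_code w by apply: gauss_code_del gw.
have gw' : gauss_code ([:: (a, ~~ t, s); (a, t, s)] ++ w).
  by apply: perm_gauss_code gw; apply/permP => q /=; lia.
exists gw'; exists 0 => //=; apply/knot_ofP.
apply: (@rst_trans _ _ _ (GaussDiagram gw0)); first exact/rst_step/R1.
apply/rst_sym/rst_step; rewrite /= -{2}[t]negbK; exact: R1.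
Qed.

Lemma reach_R2_add a b o s u v :
  a != b -> a \notin [seq e.1.1 | e : endpoint <- u ++ v] ->
  b \notin [seq e.1.1 | e : endpoint <- u ++ v] ->
  reach 0 (u ++ v) ([:: tail a s; tail b (~~ s)] ++ u ++
                    ordered o (head a s) (head b (~~ s)) ++ v).
Proof.
move=> ab fa fb; apply: reach_reidemeister_inv; first exact: R2.
move=> guv; apply: (@perm_gauss_code
  [:: tail a s, (a, ~~ true, s), tail b (~~ s), (b, ~~ true, ~~ s) & u ++ v]).
  by apply/permP=> q; case: o => /=; rewrite !count_cat /= ?count_cat /=; lia.
by apply/gauss_code_add/gauss_code_add; rewrite //= !inE !negb_or ab.
Qed.

Lemma reach_R2_del a b o s u v :
  reach 0 ([:: tail a s; tail b (~~ s)] ++ u ++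
                    ordered o (head a s) (head b (~~ s)) ++ v) (u ++ v).
Proof.
apply: reach_reidemeister; first exact: R2.
move=> g; apply: (@gauss_code_del b true (~~ s)).
apply: (@gauss_code_del a true s).
apply: perm_gauss_code g.
by apply/permP=> q; case: o => /=; rewrite !count_cat /= ?count_cat /=; lia.
Qed.

(** When all three signs are +1, the sign conditions of R3 force x = y = z and
d = true: the three pairs of neighbours are all in order or all reversed. *)
Lemma reach_R3 (k : bool) (x : bool) a b c u v w :
  let top x' := ordered x' (over a) (over b) in
  let mid x' := ordered x' (under a) (over c) in
  let bot x' := ordered x' (under b) (under c) in
  let arrange x' :=
    top x' ++ u ++ (if k then mid x' ++ v ++ bot x' else bot x' ++ v ++ mid x')
      ++ w in
  reach 0 (arrange x) (arrange (~~ x)).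
Proof.
move=> top mid bot arrange; apply: reach_reidemeister; last first.
  apply: perm_gauss_code; apply/permP=> q; rewrite /arrange /top /mid /bot.
  by case: (k); case: (x) => /=; rewrite !count_cat /= ?count_cat /=; lia.
by have := R3 a b c x x x true k u v w; rewrite !addbb.
Qed.

(** * A tail passes a head *)

Lemma fresh_label (w : seq endpoint) :
  exists n, forall m, n <= m -> m \notin [seq e.1.1 | e : endpoint <- w].
Proof.
exists (\max_(e <- w) e.1.1).+1 => m; apply: contraL => /mapP[e ew ->].
by rewrite -leqNgt; exact: leq_bigmax_seq ew isT.
Qed.

(** The hypothesis is an R3 move on a, b and x, where x and y are to be the
arrows created by an R2 move, with tails right after that of b and heads right
before that of a.  What the R3 move does to the third pair of neighbours, formed
by the tail of a and the head of b, is left to P' and Q': that pair may lie in P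
or in Q, or straddle the base point. *)
Lemma reach_swap_via_R3 a b P Q P' Q' :
  (forall x y,
     reach 0
       ([:: over b; over x] ++ (tail y false :: P ++ [:: head y false]) ++
          [:: under x; under a] ++ Q)
       ([:: over x; over b] ++ (tail y false :: P' ++ [:: head y false]) ++
          [:: under a; under x] ++ Q')) ->
  reach 2 (over b :: P ++ under a :: Q) (over b :: P' ++ under a :: Q').
Proof.
move=> r3; have [n fresh] := fresh_label (P ++ under a :: Q ++ [:: over b]).
set x := n; set y := n.+1.
have xy : x != y by rewrite /x /y; lia.
have add : reach 0 (over b :: P ++ under a :: Q)
   ([:: over b; over x; tail y false] ++ P ++
    [:: head y false; under x; under a] ++ Q).
  apply: (reach0_trans (@reach_rot [:: over b] _)); rewrite -catA /=.
  have := @reach_R2_add x y false true P (under a :: Q ++ [:: over b]) xy.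
  move=> /(_ (fresh x _)) /(_ (fresh y _)) r.
  apply: (reach0_trans (r _ _)); rewrite ?leqnn ?leqnSn //.
  have := @reach_rot ([:: over x; tail y false] ++ P ++
    [:: head y false; under x; under a] ++ Q) [:: over b].
  by rewrite /= -!catA /=.
have del : reach 0
   ([:: over b; over x; tail y false] ++ P' ++
    [:: head y false; under x; under a] ++ Q')
   (over b :: P' ++ under a :: Q').
  apply: (reach0_trans (@reach_rot [:: over b] _)); rewrite /= -!catA /=.
  apply: (reach0_trans
    (@reach_R2_del x y false true P' (under a :: Q' ++ [:: over b]))).
  by have := @reach_rot (P' ++ under a :: Q') [:: over b]; rewrite -catA.
apply: (reach0_trans add).
(* R3 has put the tail of b between those of x and y, and the head of a between
   those of y and x; one FO and one FU move them out. *)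
have := r3 x y; rewrite /= -!catA => r; apply: (reach0_trans r).
apply: (@reach_trans 1 1); first exact: (@reach_FO x true b true [::]).
apply: (@reach_trans0 1); last exact: del.
have := @reach_FU a true x true
  ([:: over b; over x; tail y false] ++ P' ++ [:: head y false]) Q'.
by rewrite /= -!catA.
Qed.

(** If the two ends belong to the same arrow, then it is isolated.  Otherwise,
read the code from the tail of b: the pair to be exchanged comes before or after
the head of a, and these are the two cyclic orders that R3 allows. *)
Lemma reach_under_over a b pre post :
  reach 2 (pre ++ [:: under b, over a & post])
          (pre ++ [:: over a, under b & post]).
Proof.
apply: (@reach_conj 2 pre [:: under b; over a] [:: over a; under b]) => w.
have [->|ab] := eqVneq a b.
  exact: (reach_weaken _ (@reach_R1_swap b false true [::] w)).
suff r : over b \in w -> under a \in w ->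
    reach 2 ([:: under b; over a] ++ w) ([:: over a; under b] ++ w).
  move=> gw; have /andP[_ /allP ends] := gw; apply: r.
    have := ends (under b) (mem_head _ _); rewrite !inE.
    by case/or3P=> // /eqP // [] /eqP; rewrite eq_sym (negPf ab).
  have := ends (over a); rewrite !inE eqxx orbT => /(_ isT).
  by case/or3P=> // /eqP // [] /eqP; rewrite (negPf ab).
case/splitPr=> v v' aw.
have : (under a \in v) || (under a \in v').
  by move: aw; rewrite mem_cat inE => /or3P[->|/eqP|->] //; rewrite orbT.
case/orP=> /splitPr[v1 v2].
- rewrite [X in reach _ X]catA [X in reach _ _ X]catA; apply: reach_rotate.
  have := @reach_swap_via_R3 a b (v' ++ [:: under b; over a] ++ v1) v2
    (v' ++ [:: over a; under b] ++ v1) v2.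
  rewrite /= -!catA /=; apply=> x y.
  have := @reach_R3 true true b x a (tail y false :: v')
    (v1 ++ [:: head y false]) v2.
  by rewrite /= -!catA.
- rewrite [X in reach _ X]catA [X in reach _ _ X]catA; apply: reach_rotate.
  have := @reach_swap_via_R3 a b v1 (v2 ++ [:: under b; over a] ++ v)
    v1 (v2 ++ [:: over a; under b] ++ v).
  rewrite /= -!catA /=; apply=> x y.
  have := @reach_R3 false true b x a
    (tail y false :: v1 ++ [:: head y false]) v2 v.
  by rewrite /= -!catA.
Qed.

(** * Unknotting an alternating code of diameters *)

(** The innermost arrow of a nested family is isolated, so R1 applies
repeatedly. *)
Lemma reach_nested t l u v :
  reach 0 (u ++ [seq (a, t, true) | a <- rev l] ++
             [seq (a, ~~ t, true) | a <- l] ++ v) (u ++ v).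
Proof.
elim: l u v => [|a l IHl] u v; first exact: reach_refl.
rewrite rev_cons map_rcons cat_rcons /=; apply: reach0_trans (IHl u v).
rewrite catA [X in reach _ _ X]catA; exact: reach_R1.
Qed.

Fixpoint riffle T (s t : seq T) : seq T :=
  match s, t with
  | x :: s', y :: t' => [:: x, y & riffle s' t']
  | [::], _ => t
  | _, [::] => s
  end.

Lemma riffle_cons T (a : T) s t :
  size s = (size t).+1 -> riffle (a :: t) s = a :: riffle s t.
Proof.
elim: t a s => [|b t IHt] a [|x s] //= [eq_size].
by rewrite -IHt.
Qed.

Lemma riffle_rcons T (a : T) s t :
  size s = size t -> riffle (rcons s a) t = rcons (riffle s t) a.
Proof. by elim: s t => [|x s IHs] [|y t] //= [/IHs->]. Qed.

(** The head of b passes the tails of ys one after the other, from the right,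
while the tail of b passes those of xs.  The R3 move for the n-th pair of
entries of ys and xs uses their heads, which the riffle makes adjacent; that
move brings b next to the ends needed by the following one. *)
Lemma reach_cascade b ys xs P R : size ys = size xs ->
  reach 0
    (overs (rev xs) ++ over b :: P ++ unders (riffle ys xs) ++
       overs (rev ys) ++ under b :: R)
    (over b :: overs (rev xs) ++ P ++ unders (riffle xs ys) ++
       under b :: overs (rev ys) ++ R).
Proof.
elim: ys xs P R => [|a ys IH] [|x xs] P R //=.
  by move=> _; apply: reach_refl.
case=> eq_size; rewrite !rev_cons !map_rcons !cat_rcons.
have := IH xs (over x :: P ++ [:: under x; under a]) (over a :: R) eq_size.
rewrite /= -!catA /=; apply: reach0_trans; apply: reach_rotate.
have := @reach_R3 false false b x a P
  (unders (riffle ys xs) ++ overs (rev ys)) (R ++ overs (rev xs)).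
by rewrite /= -!catA /= -!catA.
Qed.

(** Pairs are absorbed from the left: each new head passes the heads gathered
so far, which reverses their order, and then the new tail passes all heads. *)
Lemma reach_gather s u v :
  reach ('C(size s, 2) + 2 * 'C((size s).+1, 2))
    (u ++ flatten [seq [:: under q.1; over q.2] | q <- s] ++ v)
    (u ++ overs (unzip2 s) ++ unders (rev (unzip1 s)) ++ v).
Proof.
elim/last_ind: s u v => [|s [a b] IHs] u v; first exact: reach_refl.
rewrite map_rcons flatten_rcons /unzip1 /unzip2 !map_rcons rev_rcons.
rewrite -/(unzip1 s) -/(unzip2 s) -catA /=.
set m := size s.
have -> : 'C(size (rcons s (a, b)), 2) + 2 * 'C((size (rcons s (a, b))).+1, 2) =
    ('C(m, 2) + 2 * 'C(m.+1, 2)) + (m + 2 * m.+1).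
  by rewrite size_rcons -/m !binS !bin1 !bin0; lia.
apply: (reach_trans (IHs _ _)).
have sz : size (unders (rev (unzip1 s))) = m.
  by rewrite size_map size_rev size_map.
have us := @reach_block_swap 1 (unders (rev (unzip1 s))) [:: under a].
apply: (@reach_trans _ _ _ (u ++ overs (unzip2 s) ++ under a ::
    unders (rev (unzip1 s)) ++ over b :: v)).
  have := us _ (u ++ overs (unzip2 s)) (over b :: v).
  rewrite sz mul1n muln1 -!catA; apply=> x y u' v' /mapP[c _ ->].
  by rewrite inE => /eqP->; apply: reach_FU.
have := @reach_block_swap 2 (under a :: unders (rev (unzip1 s))) [:: over b] _
  (u ++ overs (unzip2 s)) v.
rewrite /= sz muln1 -!catA cat_rcons; apply=> x y u' v'.
rewrite -/(unders (a :: rev (unzip1 s))) => /mapP[c _ ->].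
by rewrite inE => /eqP->; apply: reach_under_over.
Qed.

(** Each step is a cascade for the next pair (a, b) of s.  The head of a, the
last of the heads gathered in decreasing order, is in front of the riffled
heads, and a riffle of xs and ys preceded by a is a riffle of a :: ys and xs:
this provides the adjacent heads that the cascade needs.  The cascade leaves a riffle
of xs and a :: ys followed by the head of b, that is, a riffle of rcons xs b and
a :: ys, as required by the next step. *)
Lemma reach_unwind s xs ys : size xs = (size ys).+1 ->
  reach 0
    (overs (rev xs) ++ overs (unzip2 s) ++ unders (rev (unzip1 s)) ++
       unders (riffle xs ys) ++ overs (rev ys) ++
       flatten [seq [:: over q.1; under q.2] | q <- s])
    (overs (rev (xs ++ unzip2 s)) ++
       unders (riffle (xs ++ unzip2 s) (rev (unzip1 s) ++ ys)) ++
       overs (rev (rev (unzip1 s) ++ ys))).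
Proof.
elim: s xs ys => [|[a b] s IHs] xs ys eq_size /=.
  by rewrite !cats0; apply: reach_refl.
have := IHs (rcons xs b) (a :: ys); rewrite /= size_rcons eq_size => /(_ erefl).
rewrite rev_rcons riffle_rcons ?eq_size // map_rcons !cat_rcons !rev_cons.
rewrite cat_rcons !map_rcons /= !cat_rcons; apply: reach0_trans.
have := @reach_cascade b (a :: ys) xs
  (overs (unzip2 s) ++ unders (rev (unzip1 s)))
  (flatten [seq [:: over q.1; under q.2] | q <- s]) (esym eq_size).
by rewrite riffle_cons // rev_cons !map_rcons -!catA /= !cat_rcons.
Qed.

Lemma reach_unriffle xs ys u v : size xs = (size ys).+1 ->
  reach 'C(size xs, 2) (u ++ unders (riffle xs ys) ++ v)
                       (u ++ unders (xs ++ ys) ++ v).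
Proof.
elim: ys xs u v => [|a ys IH] [|x xs] u v //= [eq_size].
  by case: xs eq_size => //= _; apply: reach_refl.
have -> : 'C((size xs).+1, 2) = 'C(size xs, 2) + size xs by rewrite binS bin1.
have := IH xs (u ++ [:: under x; under a]) v eq_size.
rewrite -!catA /= => r; apply: (reach_trans r).
have := @reach_block_swap 1 [:: under a] (unders xs) _ (u ++ [:: under x])
  (unders ys ++ v).
rewrite /= !mul1n size_map !map_cat -!catA /=; apply=> y z u' v'.
by rewrite inE => /eqP-> /mapP[c _ ->]; apply: reach_FU.
Qed.

(** The three stages: separate the first bracket, unwind the second one, and
undo the riffle. *)
Lemma reach_nil x s :
  reach ('C(size s, 2) + 3 * 'C((size s).+1, 2))
    (over x :: flatten [seq [:: under q.1; over q.2] | q <- s] ++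
     under x :: flatten [seq [:: over q.1; under q.2] | q <- s]) [::].
Proof.
have -> : 'C(size s, 2) + 3 * 'C((size s).+1, 2) =
  ('C(size s, 2) + 2 * 'C((size s).+1, 2)) + 'C((size s).+1, 2) by lia.
apply: reach_trans; first exact: (@reach_gather s [:: over x]).
have /= r := @reach_unwind s [:: x] [::] erefl; apply: (reach0_trans r).
set xs := x :: _; set ys := _ ++ [::].
have eq_size : size xs = (size ys).+1.
  by rewrite /xs /ys /= cats0 size_rev !size_map.
have szx : size xs = (size s).+1 by rewrite /= size_map.
have := @reach_unriffle xs ys (overs (rev xs)) (overs (rev ys)) eq_size.
rewrite szx => r2; apply: (reach_trans0 r2).
rewrite map_cat -catA.
have /= r3 := @reach_nested true xs [::]; apply: (reach0_trans (r3 _)).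
by have := @reach_nested false (rev ys) [::] [::]; rewrite revK cats0.
Qed.

(** * The torus knot *)

Lemma mkseq_odd T (f : nat -> T) k :
  mkseq f k.*2.+1 =
  f 0 :: flatten [seq [:: f i.*2.+1; f i.*2.+2] | i <- iota 0 k].
Proof.
elim: k => [|k IHk] //.
rewrite /mkseq (_ : k.+1.*2.+1 = k.*2.+1 + 2) ?iotaD ?map_cat; last by lia.
rewrite -/(mkseq f _) IHk -(addn1 k) iotaD map_cat flatten_cat /=.
by rewrite !add0n.
Qed.

Lemma torus_codeE k :
  let s := [seq (i.*2.+1, i.*2.+2) | i <- iota 0 k] in
  torus_code k.*2.+1 =
    over 0 :: flatten [seq [:: under q.1; over q.2] | q <- s] ++
    under 0 :: flatten [seq [:: over q.1; under q.2] | q <- s].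
Proof.
set p := k.*2.+1 => s.
rewrite /torus_code /mkseq mul2n -addnn iotaD map_cat add0n.
have -> : iota p p = map (addn p) (iota 0 p) by rewrite -iotaDl addn0.
rewrite -map_comp -!/(mkseq _ p) !mkseq_odd /s -!map_comp /=.
congr (_ :: flatten _ ++ _ :: flatten _).
- apply/eq_in_map=> i; rewrite mem_iota add0n /= => lt_ik.
  by rewrite !negbK odd_double !modn_small // /p; lia.
- by rewrite addn0 modnn addn0 odd_double.
- apply/eq_in_map=> i; rewrite mem_iota add0n /= => lt_ik.
  by rewrite !oddD /= !odd_double !modnDl !modn_small // /p; lia.
Qed.

(** This is sharper than the bound on F by (p - 1) / 2. *)
Lemma torus_knot_path p (podd : odd p) :
  exists2 n, n <= 'C(p, 2) & forbidden_path n (torus_knot podd) unknot.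
Proof.
have pE : p = p./2.*2.+1 by rewrite -[LHS]odd_double_half podd.
have r : reach 'C(p, 2) (torus_code p) [::].
  rewrite pE torus_codeE /=.
  have := @reach_nil 0 [seq (i.*2.+1, i.*2.+2) | i <- iota 0 p./2].
  rewrite size_map size_iota; apply: reach_weaken.
  by elim: (p./2) => // m; rewrite doubleS !binS !bin1 !bin0; lia.
have [g [n le_n path]] := r (torus_codeP podd).
exists n => //; rewrite /unknot /empty_diagram (bool_irrelevance isT g).
exact: path.
Qed.

Theorem theorem7 (p : nat) (podd : odd p) :
  exists m : nat,
    is_forbidden_number (torus_knot podd) m /\ m <= (p ^ 2 - 1) %/ 2.
Proof.
have [n le_n path] := torus_knot_path podd.
pose P m := `[< forbidden_path m (torus_knot podd) unknot >].
have exP : exists m, P m by exists n; apply/asboolP.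
exists (ex_minn exP); case: ex_minnP => m /asboolP path_m min_m; split.
  by split=> // i path_i; apply: min_m; apply/asboolP.
apply: leq_trans (min_m n _) (leq_trans le_n _); first exact/asboolP.
rewrite bin2; nia.
Qed.
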